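(* Let $G$ be any one of the groups $\mathrm{SAut}(F_2)$, $\mathrm{SOut}(F_2)$, $SL(2,\mathbb{Z})$. Let $H$ be a non-cyclic quotient of $G$, with quotient map (surjective homomorphism) $q: G\to H$. Then either $|H|>|SL(2,\mathbb{Z}_2)|$, or $H$ is isomorphic to $SL(2,\mathbb{Z}_2)$. Moreover, in the latter case, the quotient map $q$ is obtained by postcomposing the natural map $\pi: G\to SL(2,\mathbb{Z}_2)$ with an automorphism of $SL(2,\mathbb{Z}_2)$ (after identifying $H$ with $SL(2,\mathbb{Z}_2)$; equivalently, $q=\theta\circ\pi$ for some isomorphism $\theta: SL(2,\mathbb{Z}_2)\to H$).
   Context: $F_2$ is the free group of rank $2$, and $\mathbb{Z}_2=\mathbb{Z}/2\mathbb{Z}$. Every automorphism of $F_2$ induces an automorphism of the abelianization $\mathbb{Z}^2$, giving a homomorphism $\mathrm{Aut}(F_2)\to GL(2,\mathbb{Z})$, which factors through $\mathrm{Out}(F_2)$, the quotient of $\mathrm{Aut}(F_2)$ by inner automorphisms. $\mathrm{SAut}(F_2)$ (special automorphisms) is the subgroup of $\mathrm{Aut}(F_2)$ of elements whose image in $GL(2,\mathbb{Z})$ has determinant $1$, and $\mathrm{SOut}(F_2)$ is its image in $\mathrm{Out}(F_2)$. The natural map $\pi: G\to SL(2,\mathbb{Z}_2)$ is the map from $G$ to $SL(2,\mathbb{Z})$ (the induced action on $\mathbb{Z}^2$, or the identity if $G=SL(2,\mathbb{Z})$) followed by reduction modulo $2$. A quotient of $G$ is the target of a surjective group homomorphism from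 $G$; it may be infinite, in which case $|H|>|SL(2,\mathbb{Z}_2)|$ holds. *)

(* Defs.v *)
From HB Require Import structures.
From mathcomp Require Import all_boot all_order all_algebra.
From mathcomp Require Import boolp classical_sets functions cardinality.

Set Implicit Arguments.
Unset Strict Implicit.
Unset Printing Implicit Defensive.

Import GRing.Theory.

Local Open Scope group_scope.

Definition surjective (A B : Type) (f : A -> B) : Prop :=
  forall b, exists a, f a = b.

Definition cyclic_group (G : groupType) : Prop :=
  exists x : G, forall y : G, exists n : nat, y = x ^+ n \/ y = x ^- n.

Definition isomorphic (G H : groupType) : Prop :=
  exists f : {multiplicative G -> H}, bijective f.

Definition card_lt (A B : Type) : Prop :=
  ([set: A] #<= [set: B])%card /\ ~ ([set: B] #<= [set: A])%card.

Section FreeGroup.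
Variable X : choiceType.

(* The letter (x, false) stands for x and (x, true) for its inverse. *)
Definition letter : Type := X * bool.
HB.instance Definition _ := Choice.on letter.

Definition letter_inv (l : letter) : letter := (l.1, ~~ l.2).

Lemma letter_invK : involutive letter_inv.
Proof. by case=> x b; rewrite /letter_inv /= negbK. Qed.

Definition reduced (w : seq letter) : bool :=
  sorted (fun l m => m != letter_inv l) w.

Record free_group := FreeGroup { word : seq letter; _ : reduced word }.

HB.instance Definition _ := [isSub for word].
HB.instance Definition _ := [Choice of free_group by <:].

Definition push (l : letter) (w : seq letter) : seq letter :=
  if w is m :: w' then if m == letter_inv l then w' else l :: w else [:: l].

(* The reduced form of the concatenation of u and v, when v is reduced. *)
Definition word_mul (u v : seq letter) : seq letter := foldr push v u.

Lemma push_reduced l w : reduced w -> reduced (push l w).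
Proof.
case: w => [|m w] //= rw; case: ifPn => [_|ml]; first exact: path_sorted rw.
by rewrite /reduced /= ml.
Qed.

Lemma word_mul_reduced u v : reduced v -> reduced (word_mul u v).
Proof. by move=> rv; elim: u => //= l u /(push_reduced l). Qed.

Lemma pushK l w : reduced w -> push l (push (letter_inv l) w) = w.
Proof.
case: w => [|m w] /=; first by rewrite eqxx.
rewrite letter_invK; case: eqVneq => [->|_ _] /=; last by rewrite eqxx.
by case: w => [|n w] //= /andP[/negPf ->].
Qed.

Lemma word_mul_push l u v : reduced v ->
  word_mul (push l u) v = push l (word_mul u v).
Proof.
case: u => [|m u] //= rv; case: eqVneq => [->|_] //.
by rewrite pushK // word_mul_reduced.
Qed.

Lemma word_mulA u v w : reduced w ->
  word_mul u (word_mul v w) = word_mul (word_mul u v) w.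
Proof. by move=> rw; elim: u => //= l u ->; rewrite word_mul_push. Qed.

Lemma word_mul1 u : reduced u -> word_mul u [::] = u.
Proof.
elim: u => //= l u IH ru; rewrite (IH (path_sorted ru)).
by case: u ru {IH} => //= m u /andP[/negPf ->].
Qed.

Definition word_inv (u : seq letter) : seq letter := map letter_inv (rev u).

Lemma word_inv_reduced u : reduced u -> reduced (word_inv u).
Proof.
rewrite /reduced /word_inv sorted_map rev_sorted; apply: sub_sorted => l m /=.
by rewrite letter_invK eq_sym.
Qed.

Lemma word_mulV u w : reduced w -> word_mul u (word_mul (word_inv u) w) = w.
Proof.
elim: u w => [|l u IH] //= w rw.
rewrite (_ : word_mul (word_inv (l :: u)) w =
  word_mul (word_inv u) (push (letter_inv l) w)); last first.
  by rewrite /word_inv rev_cons map_rcons -cats1 /word_mul foldr_cat.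
by rewrite IH ?push_reduced // pushK.
Qed.

Definition free_one := @FreeGroup [::] isT.
Definition free_mul (u v : free_group) :=
  FreeGroup (word_mul_reduced (word u) (valP v)).
Definition free_inv (u : free_group) := FreeGroup (word_inv_reduced (valP u)).

Fact free_mulA : associative free_mul.
Proof. by move=> u v w; apply: val_inj; apply/word_mulA/valP. Qed.

Fact free_mul1g : left_id free_one free_mul.
Proof. by move=> u; apply: val_inj. Qed.

Fact free_mulg1 : right_id free_one free_mul.
Proof. by move=> u; apply: val_inj; apply/word_mul1/valP. Qed.

Fact free_mulgV : right_inverse free_one free_inv free_mul.
Proof.
move=> u; apply: val_inj => /=.
by rewrite -[word_inv _]word_mul1 ?word_mulV // word_inv_reduced ?(valP u).
Qed.

Fact free_mulVg : left_inverse free_one free_inv free_mul.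
Proof.
have invK : involutive word_inv.
  move=> u; rewrite /word_inv -map_rev revK -map_comp map_id_in // => l _ /=.
  exact: letter_invK.
move=> u; rewrite -[X in free_mul _ X](_ : free_inv (free_inv u) = u).
  exact: free_mulgV.
by apply: val_inj; apply: invK.
Qed.

HB.instance Definition _ := isGroup.Build free_group
  free_mulA free_mul1g free_mulg1 free_mulVg free_mulgV.

Definition gen (x : X) : free_group := @FreeGroup [:: (x, false)] isT.

Lemma free_group_ind (P : free_group -> Prop) :
  P 1 -> (forall x u, P u -> P (gen x * u)) ->
  (forall x u, P u -> P ((gen x)^-1 * u)) -> forall u, P u.
Proof.
move=> P1 Pg PV [w rw]; elim: w rw => [|[x b] w IH] rw.
  by rewrite (_ : FreeGroup rw = 1) //; apply: val_inj.
have rw' : reduced w := path_sorted rw.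
have push_w : push (x, b) w = (x, b) :: w.
  by case: w rw {IH rw'} => //= m w /andP[/negPf ->].
case: b rw push_w => rw push_w.
  rewrite (_ : FreeGroup rw = (gen x)^-1 * FreeGroup rw'); first exact/PV/IH.
  by apply: val_inj; rewrite /= -push_w.
rewrite (_ : FreeGroup rw = gen x * FreeGroup rw'); first exact/Pg/IH.
by apply: val_inj; rewrite /= -push_w.
Qed.

Section Lift.
Variables (G : groupType) (f : X -> G).

Let eval_letter (l : letter) : G := if l.2 then (f l.1)^-1 else f l.1.

Definition free_lift (u : free_group) : G :=
  foldr (fun l g => eval_letter l * g) 1 (word u).

Fact free_lift_is_multiplicative : {morph free_lift : u v / u * v}.
Proof.
move=> [u ru] [v rv]; rewrite /free_lift /= {ru rv}.
elim: u => [|l u IH] /=; first by rewrite mul1g.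
rewrite -mulgA -{}IH; case: (word_mul u v) => [|m w] //=.
case: eqVneq => [->|_] //=; rewrite mulgA.
by case: l => x [] /=; rewrite /eval_letter /= ?mulVg ?mulgV mul1g.
Qed.

HB.instance Definition _ :=
  isMultiplicative.Build free_group G free_lift free_lift_is_multiplicative.

Lemma free_lift_gen x : free_lift (gen x) = f x.
Proof. by rewrite /free_lift /= mulg1. Qed.

Lemma free_lift_unique (h : {multiplicative free_group -> G}) :
  (forall x, h (gen x) = f x) -> h =1 free_lift.
Proof.
have h1 (k : {multiplicative free_group -> G}) : k 1 = 1.
  by apply: (mulgI (k 1)); rewrite -gmulfM !mulg1.
have hV (k : {multiplicative free_group -> G}) u : k u^-1 = (k u)^-1.
  by apply: (mulgI (k u)); rewrite -gmulfM !mulgV h1.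
move=> hf u; elim/free_group_ind: u => [|x u IH|x u IH].
- by rewrite !h1.
- by rewrite !gmulfM IH hf -free_lift_gen.
- by rewrite !gmulfM IH !hV hf -free_lift_gen.
Qed.

End Lift.

(* The coordinate of index x of the image of u in the abelianization. *)
Definition expsum (x : X) (u : free_group) : int :=
  (\sum_(l <- word u | l.1 == x) (-1) ^+ l.2)%R.

Lemma expsumM x u v : expsum x (u * v) = (expsum x u + expsum x v)%R.
Proof.
rewrite /expsum; case: u v => [u ru] [v rv] /= {ru rv}.
elim: u => [|l u IH] /=; first by rewrite big_nil add0r.
rewrite big_cons [LHS](_ : _ = \sum_(m <- l :: word_mul u v | m.1 == x)
    (-1) ^+ m.2)%R; last first.
  case: (word_mul u v) => [|m w] //=; case: eqVneq => [->|_] //.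
  rewrite !big_cons /=; case: (l.1 == x) => //.
  by rewrite addrA signrN subrr add0r.
by rewrite !big_cons IH; case: (l.1 == x); rewrite ?addrA.
Qed.

Lemma expsum1 x : expsum x 1 = 0%R.
Proof. by rewrite /expsum big_nil. Qed.

Lemma expsumV x u : expsum x u^-1 = (- expsum x u)%R.
Proof.
by apply: (addrI (expsum x u)); rewrite -expsumM mulgV expsum1 subrr.
Qed.

Lemma expsum_gen x y : expsum x (gen y) = (y == x)%:R%R.
Proof. by rewrite /expsum /= big_cons big_nil /= addr0; case: eqP. Qed.

End FreeGroup.

Section Aut.
Variable G : groupType.

Definition is_aut (f : G -> G) : Prop :=
  {morph f : x y / x * y} /\ bijective f.

Record Aut := MkAut { aut_fun :> G -> G; _ : `[< is_aut aut_fun >] }.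

HB.instance Definition _ := [isSub for aut_fun].
HB.instance Definition _ := [Choice of Aut by <:].

Lemma autP (f : Aut) : is_aut f.
Proof. by apply/asboolP; case: f. Qed.

Lemma aut_eq (f g : Aut) : f =1 g -> f = g.
Proof. by move=> fg; apply: val_inj; apply: funext. Qed.

Lemma autM (f : Aut) : {morph f : x y / x * y}.
Proof. by case: (autP f). Qed.

HB.instance Definition _ (f : Aut) :=
  isMultiplicative.Build G G (aut_fun f) (autM f).

Lemma aut1 (f : Aut) : f 1 = 1.
Proof. by apply: (mulgI (f 1)); rewrite -autM !mulg1. Qed.

Lemma autV (f : Aut) x : f x^-1 = (f x)^-1.
Proof. by apply: (mulgI (f x)); rewrite -autM !mulgV aut1. Qed.

Fact aut_id_subproof : `[< is_aut (@id G) >].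
Proof. by apply/asboolP; split=> //; exists id. Qed.
Definition aut_id := MkAut aut_id_subproof.

Fact aut_comp_subproof (f g : Aut) : `[< is_aut (f \o g) >].
Proof.
apply/asboolP; split; first by move=> x y /=; rewrite !autM.
by apply: bij_comp; [case: (autP f) | case: (autP g)].
Qed.
Definition aut_comp (f g : Aut) := MkAut (aut_comp_subproof f g).

Fact aut_inv_ex (f : Aut) : exists g : Aut, cancel f g /\ cancel g f.
Proof.
have [fM [g fK gK]] := autP f.
have gP : `[< is_aut g >].
  apply/asboolP; split; last by exists f.
  by move=> x y; apply: (can_inj fK); rewrite fM !gK.
by exists (MkAut gP).
Qed.
Definition aut_inv (f : Aut) : Aut := projT1 (cid (aut_inv_ex f)).

Lemma aut_funK (f : Aut) : cancel f (aut_inv f).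
Proof. by rewrite /aut_inv; case: cid => ? []. Qed.
Lemma aut_invK (f : Aut) : cancel (aut_inv f) f.
Proof. by rewrite /aut_inv; case: cid => ? []. Qed.

Fact aut_compA : associative aut_comp.
Proof. by move=> f g h; apply: aut_eq. Qed.
Fact aut_comp1g : left_id aut_id aut_comp.
Proof. by move=> f; apply: aut_eq. Qed.
Fact aut_compg1 : right_id aut_id aut_comp.
Proof. by move=> f; apply: aut_eq. Qed.
Fact aut_compVg : left_inverse aut_id aut_inv aut_comp.
Proof. by move=> f; apply: aut_eq; apply: aut_funK. Qed.
Fact aut_compgV : right_inverse aut_id aut_inv aut_comp.
Proof. by move=> f; apply: aut_eq; apply: aut_invK. Qed.

HB.instance Definition _ := isGroup.Build Aut
  aut_compA aut_comp1g aut_compg1 aut_compVg aut_compgV.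

Lemma aut_mulE (f g : Aut) x : (f * g) x = f (g x).
Proof. by []. Qed.

Definition inner (f : Aut) : Prop :=
  exists a : G, forall x, f x = a * x * a^-1.

Lemma inner1 : inner 1.
Proof. by exists 1 => x; rewrite mul1g invg1 mulg1. Qed.

Lemma innerM f g : inner f -> inner g -> inner (f * g).
Proof.
move=> [a fa] [b gb]; exists (a * b) => x.
by rewrite aut_mulE fa gb invgM !mulgA.
Qed.

Lemma innerV f : inner f -> inner f^-1.
Proof.
move=> [a fa]; exists a^-1 => x; apply: (can_inj (aut_funK f)).
by rewrite (aut_invK f) fa invgK !mulgA mulgV mul1g mulgK.
Qed.

Lemma inner_normal f g : inner f -> inner (g^-1 * f * g).
Proof.
move=> [a fa]; exists (aut_inv g a) => x.
by rewrite !aut_mulE fa !autM autV; congr (_ * _ * _); apply: aut_funK.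
Qed.

Definition out_eq (f g : Aut) : bool := `[< inner (f^-1 * g) >].

Fact out_eq_refl : reflexive out_eq.
Proof. by move=> f; apply/asboolP; rewrite mulVg; apply: inner1. Qed.

Fact out_eq_sym : symmetric out_eq.
Proof.
have sym f g : out_eq f g -> out_eq g f.
  by move=> /asboolP/innerV fg; apply/asboolP; rewrite invgM invgK in fg.
by move=> f g; apply/idP/idP; apply: sym.
Qed.

Fact out_eq_trans : transitive out_eq.
Proof.
move=> g f h /asboolP fg /asboolP gh; apply/asboolP.
by have := innerM fg gh; rewrite mulgA mulgK.
Qed.

Canonical out_eq_equiv := EquivRel out_eq out_eq_refl out_eq_sym out_eq_trans.

Definition Out : Type := {eq_quot out_eq}%qT.
HB.instance Definition _ := Choice.on Out.

Definition to_Out (f : Aut) : Out := (\pi_({eq_quot out_eq}) f)%qT.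
Definition Out_repr (x : Out) : Aut := repr (x : {eq_quot out_eq})%qT.

Lemma Out_reprK : cancel Out_repr to_Out.
Proof. exact: reprK. Qed.

Lemma to_OutP f g : to_Out f = to_Out g <-> inner (f^-1 * g).
Proof.
by split=> [/eqmodP/asboolP|fg]; last by apply/eqmodP/asboolP.
Qed.

Definition out_one : Out := to_Out 1.
Definition out_mul (x y : Out) : Out := to_Out (Out_repr x * Out_repr y).
Definition out_inv (x : Out) : Out := to_Out (Out_repr x)^-1.

Lemma to_OutM f g : to_Out (f * g) = out_mul (to_Out f) (to_Out g).
Proof.
have /esym/to_OutP fI := Out_reprK (to_Out f).
have /esym/to_OutP gI := Out_reprK (to_Out g).
apply/to_OutP; set f' := Out_repr _ in fI *; set g' := Out_repr _ in gI *.
rewrite (_ : _ * _ = g^-1 * (f^-1 * f') * g * (g^-1 * g')).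
  by apply: innerM gI; apply: inner_normal.
by rewrite invgM !mulgA mulgK.
Qed.

Lemma to_OutV f : to_Out f^-1 = out_inv (to_Out f).
Proof.
have /to_OutP fI := Out_reprK (to_Out f).
apply/to_OutP; set f' := Out_repr _ in fI *.
rewrite invgK (_ : f * f'^-1 = (f^-1)^-1 * (f'^-1 * f) * f^-1).
  exact: inner_normal.
by rewrite invgK mulgA mulgK.
Qed.

Fact out_mulA : associative out_mul.
Proof.
move=> x y z; rewrite -(Out_reprK x) -(Out_reprK y) -(Out_reprK z).
by rewrite -!to_OutM mulgA.
Qed.
Fact out_mul1g : left_id out_one out_mul.
Proof. by move=> x; rewrite -(Out_reprK x) -to_OutM mul1g. Qed.
Fact out_mulg1 : right_id out_one out_mul.
Proof. by move=> x; rewrite -(Out_reprK x) -to_OutM mulg1. Qed.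
Fact out_mulVg : left_inverse out_one out_inv out_mul.
Proof. by move=> x; rewrite -(Out_reprK x) -to_OutV -to_OutM mulVg. Qed.
Fact out_mulgV : right_inverse out_one out_inv out_mul.
Proof. by move=> x; rewrite -(Out_reprK x) -to_OutV -to_OutM mulgV. Qed.

HB.instance Definition _ := isGroup.Build Out
  out_mulA out_mul1g out_mulg1 out_mulVg out_mulgV.

HB.instance Definition _ := isMultiplicative.Build Aut Out to_Out to_OutM.

End Aut.

Section SL.
Variables (n : nat) (R : comUnitRingType).

Record SL := MkSL { SL_mx :> 'M[R]_n; _ : (\det SL_mx == 1)%R }.

HB.instance Definition _ := [isSub for SL_mx].
HB.instance Definition _ := [Choice of SL by <:].

Lemma SL_det (A : SL) : (\det A = 1)%R.
Proof. by apply/eqP; case: A. Qed.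

Lemma SL_unit (A : SL) : (A : 'M_n) \in unitmx.
Proof. by rewrite unitmxE SL_det unitr1. Qed.

Fact SL_one_subproof : (\det (1%:M : 'M[R]_n) == 1)%R.
Proof. by rewrite det1. Qed.
Definition SL_one := MkSL SL_one_subproof.

Fact SL_mul_subproof (A B : SL) : (\det ((A : 'M_n) *m B) == 1)%R.
Proof. by rewrite det_mulmx !SL_det mulr1. Qed.
Definition SL_mul (A B : SL) := MkSL (SL_mul_subproof A B).

Fact SL_inv_subproof (A : SL) : (\det (invmx A) == 1)%R.
Proof. by rewrite det_inv SL_det invr1. Qed.
Definition SL_inv (A : SL) := MkSL (SL_inv_subproof A).

Fact SL_mulA : associative SL_mul.
Proof. by move=> A B C; apply: val_inj; apply: mulmxA. Qed.
Fact SL_mul1g : left_id SL_one SL_mul.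
Proof. by move=> A; apply: val_inj; apply: mul1mx. Qed.
Fact SL_mulg1 : right_id SL_one SL_mul.
Proof. by move=> A; apply: val_inj; apply: mulmx1. Qed.
Fact SL_mulVg : left_inverse SL_one SL_inv SL_mul.
Proof. by move=> A; apply: val_inj; apply/mulVmx/SL_unit. Qed.
Fact SL_mulgV : right_inverse SL_one SL_inv SL_mul.
Proof. by move=> A; apply: val_inj; apply/mulmxV/SL_unit. Qed.

HB.instance Definition _ := isGroup.Build SL
  SL_mulA SL_mul1g SL_mulg1 SL_mulVg SL_mulgV.

End SL.

Section SLMap.
Variables (n : nat) (R S : comUnitRingType) (f : {rmorphism R -> S}).

Fact SL_map_subproof (A : SL n R) : (\det (map_mx f A) == 1)%R.
Proof. by rewrite det_map_mx SL_det rmorph1. Qed.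
Definition SL_map (A : SL n R) : SL n S := MkSL (SL_map_subproof A).

Fact SL_mapM : {morph SL_map : A B / A * B}.
Proof. by move=> A B; apply: val_inj; apply: map_mxM. Qed.

HB.instance Definition _ := isMultiplicative.Build _ _ SL_map SL_mapM.

End SLMap.

Definition mod2 : SL 2 int -> SL 2 'Z_2 := SL_map (intr : {rmorphism int -> 'Z_2}).
HB.instance Definition _ := Multiplicative.on mod2.

Notation F2 := (free_group 'I_2).

(* Column j holds the coordinates of the image of the j-th generator, so this
   is the matrix acting on column vectors; the product of Aut being the
   composition of functions, the map is a homomorphism. *)
Definition ab_mx (f : Aut F2) : 'M[int]_2 :=
  (\matrix_(i, j) expsum i (f (gen j)))%R.

Lemma expsum_aut (f : Aut F2) i u :
  expsum i (f u) = (\sum_k ab_mx f i k * expsum k u)%R.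
Proof.
have ab_gen x : (\sum_k ab_mx f i k * expsum k (gen x))%R = ab_mx f i x.
  rewrite (bigD1 x) //= expsum_gen eqxx mulr1 big1 ?addr0 // => k kx.
  by rewrite expsum_gen eq_sym (negPf kx) mulr0.
elim/free_group_ind: u => [|x u IH|x u IH].
- by rewrite aut1 expsum1 big1 // => k _; rewrite expsum1 mulr0.
- rewrite autM expsumM IH; under [RHS]eq_bigr do rewrite expsumM mulrDr.
  by rewrite big_split /= ab_gen mxE.
- rewrite autM autV expsumM expsumV IH.
  under [RHS]eq_bigr do rewrite expsumM expsumV mulrDr mulrN.
  by rewrite big_split /= sumrN ab_gen mxE.
Qed.

Lemma ab_mxM f g : ab_mx (f * g) = (ab_mx f *m ab_mx g)%R.
Proof.
apply/matrixP => i j; rewrite !mxE /= expsum_aut.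
by apply: eq_bigr => k _; rewrite [ab_mx g _ _]mxE.
Qed.

Lemma ab_mx1 : ab_mx 1 = 1%:M%R.
Proof. by apply/matrixP => i j; rewrite !mxE /= expsum_gen eq_sym. Qed.

Lemma ab_mx_unit f : ab_mx f \in unitmx.
Proof.
have/mulmx1_unit[] // : (ab_mx f *m ab_mx (f^-1)%g = 1%:M)%R.
by rewrite -ab_mxM mulgV ab_mx1.
Qed.

Lemma ab_mx_inner f : inner f -> ab_mx f = 1%:M%R.
Proof.
move=> [a fa]; apply/matrixP => i j; rewrite !mxE fa !expsumM expsumV.
by rewrite addrAC subrr add0r expsum_gen eq_sym.
Qed.

Lemma ab_mx_out f g : to_Out f = to_Out g -> ab_mx f = ab_mx g.
Proof.
move=> /to_OutP/ab_mx_inner fg.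
by rewrite -[g](mulVKg f) ab_mxM fg mulmx1.
Qed.

Definition special (f : Aut F2) : bool := (\det (ab_mx f) == 1)%R.

Fact special_group_closed : group_closed special.
Proof.
split; first by rewrite unfold_in /special ab_mx1 det1.
move=> f g /eqP sf /eqP sg; rewrite unfold_in /special.
have: (\det (ab_mx (f / g * g)%g) == 1)%R by rewrite mulgVK sf.
by rewrite ab_mxM det_mulmx sg mulr1.
Qed.

Record SAutF2 := MkSAut { SAut_val :> Aut F2; _ : special SAut_val }.

HB.instance Definition _ := [isSub for SAut_val].
HB.instance Definition _ := [Choice of SAutF2 by <:].
HB.instance Definition _ := SubChoice_isSubGroup.Build
  (Aut F2) special SAutF2 special_group_closed.

Definition special_out (x : Out F2) : bool :=
  `[< exists2 f : Aut F2, special f & to_Out f = x >].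

Fact special_out_group_closed : group_closed special_out.
Proof.
have [s1 sF] := special_group_closed.
split; first by apply/asboolP; exists 1.
move=> _ _ /asboolP[f sf <-] /asboolP[g sg <-]; apply/asboolP.
by exists (f / g); [exact: sF | rewrite to_OutM to_OutV].
Qed.

Record SOutF2 := MkSOut { SOut_val :> Out F2; _ : special_out SOut_val }.

HB.instance Definition _ := [isSub for SOut_val].
HB.instance Definition _ := [Choice of SOutF2 by <:].
HB.instance Definition _ := SubChoice_isSubGroup.Build
  (Out F2) special_out SOutF2 special_out_group_closed.

Definition SAut_SL (f : SAutF2) : SL 2 int :=
  @MkSL 2 int (ab_mx f) (valP f).

Fact SAut_SLM : {morph SAut_SL : f g / f * g}.
Proof. by move=> f g; apply: val_inj; apply: ab_mxM. Qed.

HB.instance Definition _ := isMultiplicative.Build _ _ SAut_SL SAut_SLM.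

(* The matrix does not depend on the representative of x, by ab_mx_out. *)
Fact SOut_SL_subproof (x : SOutF2) : (\det (ab_mx (Out_repr x)) == 1)%R.
Proof.
have /asboolP[f /eqP sf fx] := valP x.
by rewrite (@ab_mx_out (Out_repr x) f) ?sf // Out_reprK.
Qed.

Definition SOut_SL (x : SOutF2) : SL 2 int := MkSL (SOut_SL_subproof x).

Fact SOut_SLM : {morph SOut_SL : x y / x * y}.
Proof.
move=> x y; apply: val_inj; rewrite /= -ab_mxM; apply: ab_mx_out.
by rewrite to_OutM !Out_reprK.
Qed.

HB.instance Definition _ := isMultiplicative.Build _ _ SOut_SL SOut_SLM.

Variant source := fromSAut | fromSOut | fromSL.

Definition source_group (s : source) : groupType :=
  match s with
  | fromSAut => SAutF2
  | fromSOut => SOutF2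
  | fromSL => SL 2 int
  end.

Definition to_SL2Z (s : source) : {multiplicative source_group s -> SL 2 int} :=
  match s with
  | fromSAut => SAut_SL
  | fromSOut => SOut_SL
  | fromSL => idfun
  end.

Definition natural_map (s : source) :
    {multiplicative source_group s -> SL 2 'Z_2} := mod2 \o to_SL2Z s.

(* Main.v *)
Require Import Defs.
From HB Require Import structures.
From mathcomp Require Import all_boot all_order all_algebra.
From mathcomp Require Import boolp classical_sets functions cardinality.
From mathcomp Require Import zify ring.

(* SOut(F_2) and SL(2, Z) are quotients of SAut(F_2), compatibly with the natural
   maps, so it suffices to treat SAut(F_2). By Nielsen's method it is generated by
   sigma1 : x -> xy, sigma2 : y -> yx^-1 and sigma3 : x -> yx, which satisfy the
   relations of the braid group on four strands. If the images a, b, c of these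
   generators in H are such that a and b commute, then a = b = c and H is cyclic.
   Otherwise 1, a, b, ab, ba, aba are distinct; if H has at most six elements these
   are all of them, which forces a^2 = b^2 = 1 and c = a. Hence the image in H
   of an element of SAut(F_2) has a normal form in a and b that does not depend on H,
   so all such quotient maps, among them the natural map, have the same kernel. *)

Set Implicit Arguments.
Unset Strict Implicit.
Unset Printing Implicit Defensive.

Import GRing.Theory.

Local Open Scope group_scope.

(** * Cancellation in free groups *)

Section CommonPrefix.
Variable T : eqType.
Implicit Types s t : seq T.

Fixpoint lcp s t : nat :=
  match s, t with
  | x :: s', y :: t' => if x == y then (lcp s' t').+1 else 0
  | _, _ => 0
  end.

Lemma lcpC s t : lcp s t = lcp t s.
Proof.
elim: s t => [|x s IH] [|y t] //=.
by rewrite eq_sym IH.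
Qed.

Lemma lcpp s : lcp s s = size s.
Proof. by elim: s => //= x s ->; rewrite eqxx. Qed.

Lemma lcp_ultra s t r : minn (lcp s t) (lcp t r) <= lcp s r.
Proof.
elim: s t r => [|x s IH] [|y t] [|z r] //=; rewrite ?minn0 ?min0n //.
case: (eqVneq x y) => [->|_]; last by rewrite min0n.
case: (eqVneq y z) => [_|_]; last by rewrite minn0.
by rewrite minnSS ltnS.
Qed.

Lemma lcp_size s t : lcp s t <= size s.
Proof. by elim: s t => [|x s IH] [|y t] //=; case: ifP => // _; apply: IH. Qed.

Lemma lcp_take k s : k <= size s -> lcp (take k s) s = k.
Proof. by elim: s k => [|x s IH] [|k] //= ks; rewrite eqxx IH. Qed.

Lemma lcp_nth x0 k s t i : k <= lcp s t -> i < k -> nth x0 s i = nth x0 t i.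
Proof.
elim: s t k i => [|x s IH] [|y t] [|k] i //=.
case: eqVneq => // ->; rewrite ltnS => ks.
by case: i => //= i; rewrite ltnS => ik; apply: (IH t k).
Qed.

End CommonPrefix.

Section WordLength.
Variable X : choiceType.
Local Notation F := (free_group X).
Implicit Types u v p : F.

Definition len u := size (word u).

(* The Gromov product of u and v with respect to 1, in the Cayley tree. *)
Definition gp u v := lcp (word u) (word v).

Lemma lenV u : len u^-1 = len u.
Proof. by rewrite /len /= /word_inv size_map size_rev. Qed.

Lemma len_eq0 u : (len u == 0) = (u == 1).
Proof. by rewrite size_eq0. Qed.

Lemma gpC u v : gp u v = gp v u. Proof. exact: lcpC. Qed.

Lemma gp_ultra v u (w : F) k : k <= gp u v -> k <= gp v w -> k <= gp u w.
Proof.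
by move=> uv vw; apply: leq_trans (lcp_ultra _ (word v) _); rewrite leq_min uv.
Qed.

Lemma word_mul_cat (s t : seq (letter X)) : reduced (s ++ t) -> word_mul s t = s ++ t.
Proof.
elim: s => //= l s IH r; rewrite IH; last exact: path_sorted r.
by case: (s ++ t) r => //= m w /andP[/negPf->].
Qed.

(** Only the common prefix cancels: once it is stripped, the first letters differ and the
    concatenation is reduced. *)
Lemma size_word_mulV (s t : seq (letter X)) : reduced s -> reduced t ->
  size (word_mul (word_inv s) t) + 2 * lcp s t = size s + size t.
Proof.
have invS l (r : seq (letter X)) : word_inv (l :: r) = rcons (word_inv r) (letter_inv l).
  by rewrite /word_inv rev_cons map_rcons.
elim: s t => [|l s IH] t rs rt; first by rewrite /= muln0 addn0.
case: t rt => [|m t] rt.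
  rewrite word_mul1 ?word_inv_reduced //= /word_inv size_map size_rev /=; lia.
rewrite /=; case: eqVneq => [lm|lm].
  rewrite -{}lm in rt *; have := IH t (path_sorted rs) (path_sorted rt).
  rewrite invS -cats1 /word_mul foldr_cat /= letter_invK eqxx -/(word_mul _ _); lia.
rewrite word_mul_cat; first by rewrite size_cat /word_inv size_map size_rev /=; lia.
have := word_inv_reduced rs; rewrite invS /reduced -cats1 -catA.
case: (word_inv s) => [|k r] /=; first by rewrite letter_invK eq_sym lm.
rewrite !cat_path /= !letter_invK andbT => /andP[-> ->] /=.
by rewrite eq_sym lm.
Qed.

Lemma len_divl u v : len (u^-1 * v) + 2 * gp u v = len u + len v.
Proof. by apply: size_word_mulV; apply: valP. Qed.

Lemma len_mul u v : len (u * v) + 2 * gp u^-1 v = len u + len v.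
Proof. by rewrite -{1}[u]invgK len_divl lenV. Qed.

Lemma gp_leql u v : gp u v <= len u.
Proof. exact: lcp_size. Qed.

Lemma prefix_ex u k : k <= len u -> exists2 p, len p = k & gp p u = k.
Proof.
move=> ku; have rp : reduced (take k (word u)) by apply: take_sorted; apply: (valP u).
by exists (FreeGroup rp); rewrite /len /gp /= ?lcp_take // size_takel.
Qed.

(* Read from both ends, u and u^-1 can only agree up to the middle of u: past it,
   either the middle letter is its own inverse, or the two middle letters cancel. *)
Lemma gpV_lt u : u != 1 -> 2 * gp u u^-1 < len u.
Proof.
rewrite ltnNge -len_eq0 => u0; apply/negP => le_u.
have := valP u; have := gp_leql u u^-1; move: u0 le_u.
rewrite /len /gp /= -[\val u]/(word u).
set w := word u => w0 le_w lcp_le rw.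
have [x0 _] : exists x : letter X, True by case: (w) w0 => // x; exists x.
have agree i : i < lcp w (word_inv w) ->
    nth x0 w i = letter_inv (nth x0 w (size w - i.+1)).
  move=> ic; have iw : i < size w := leq_trans ic lcp_le.
  rewrite (lcp_nth x0 (leqnn _) ic) (nth_map x0) ?size_rev //.
  by rewrite nth_rev.
have self (l : letter X) : l <> letter_inv l by case: l => y [].
have [o|e] := boolP (odd (size w)).
  have ic : (size w)./2 < lcp w (word_inv w) by lia.
  have := agree _ ic; rewrite (_ : size w - _ = (size w)./2); last by lia.
  exact: self.
have ic : (size w)./2.-1 < lcp w (word_inv w) by lia.
have := agree _ ic; rewrite (_ : size w - _ = (size w)./2.-1.+1); last by lia.
have /(sortedP x0)/(_ (size w)./2.-1) := rw.
rewrite (_ : _ < size w); last by lia.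
by move=> /(_ isT) /eqP ne eq; apply: ne; rewrite eq letter_invK.
Qed.

(** * Lengths of products under local cancellation bounds *)

Section LocalGrowth.
Variable e : letter X -> F.
Hypothesis eV : forall l, e (letter_inv l) = (e l)^-1.
Hypothesis e_neq1 : forall l, e l != 1.

Local Notation cancellation l m := (gp (e l)^-1 (e m)).

(** Nielsen's conditions: neighbours cancel at most half of a factor, and no factor is consumed
    entirely from its two sides. *)
Hypothesis cancel_pair : forall l m, m != letter_inv l ->
  2 * cancellation l m <= len (e m).
Hypothesis cancel_triple : forall l m n, m != letter_inv l -> n != letter_inv m ->
  cancellation l m + cancellation m n < len (e m).

Definition eval_word (w : seq (letter X)) : F := foldr (fun l u => e l * u) 1 w.

Lemma len_eval_word w : reduced w -> size w <= len (eval_word w).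
Proof.
have len_gt0 l : 0 < len (e l) by rewrite lt0n len_eq0.
have pairV l m : m != letter_inv l -> 2 * cancellation l m <= len (e l).
  move=> lm; have := @cancel_pair (letter_inv m) (letter_inv l).
  by rewrite letter_invK eq_sym !eV invgK lenV gpC; apply.
case: w => // l w rw.
pose c l (w : seq (letter X)) := if w is m :: _ then cancellation l m else 0.
(* Stronger invariant: the part of [e l] that the next factor does not cancel survives as a prefix
   of the product, and every later factor adds at least one letter. *)
suff [_ ge_w] : len (e l) - c l w <= gp (eval_word (l :: w)) (e l) /\
    len (e l) - c l w + size w <= len (eval_word (l :: w)).
  apply: leq_trans ge_w; rewrite /= -add1n leq_add2r subn_gt0.
  case: w rw => //= m w /andP[/pairV + _]; have := len_gt0 l; lia.
elim: w l rw => [|l w IH] k /=.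
  by rewrite mulg1 /c subn0 addn0 /gp lcpp.
case/andP=> kl rw; have [gp_l len_l] := IH l rw.
set g := eval_word (l :: w) in gp_l len_l *; rewrite -/(eval_word w) -/g.
have small : c l w + cancellation k l < len (e l).
  case: w rw {IH gp_l g len_l} => [|m w] /=; last first.
    by case/andP=> lm _; rewrite addnC cancel_triple.
  by move=> _; have := cancel_pair kl; have := len_gt0 l; lia.
(* By [small], [g] agrees with [e l] beyond [cancellation k l]; if it also agreed with [(e k)^-1]
   that far, so would [(e k)^-1] and [e l]. *)
have le_gp : gp (e k)^-1 g <= cancellation k l.
  rewrite leqNgt; apply/negP => lt_gp.
  have lt_l : cancellation k l < gp g (e l) by apply: leq_trans gp_l; lia.
  by have := gp_ultra lt_gp lt_l; rewrite ltnn.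
(* The second formula concerns [(e k * g)^-1 * e k = g^-1] and yields the common prefix of [e k * g]
   and [e k]. *)
have := len_mul (e k) g; have := len_divl (e k * g) (e k).
rewrite invgM mulgVK lenV.
rewrite -[e l * _]/g; split; lia.
Qed.

End LocalGrowth.
End WordLength.

(** * Nielsen reduced pairs *)

Section NielsenReduced.
Variable X : choiceType.
Hypothesis two_gens : forall x y z : X, x != y -> y != z -> x = z.
Local Notation L := (letter X).
Local Notation F := (free_group X).
Variable e : L -> F.
Hypothesis eV : forall l, e (letter_inv l) = (e l)^-1.
Hypothesis e_neq1 : forall l, e l != 1.
(** The end of Nielsen's descent: no transvection followed by a conjugation shortens the pair. *)
Hypothesis e_min : forall (a b : L) (p : F), a.1 != b.1 ->
  len (e a) + len (e b) <= len (e a ^ p) + len ((e a * e b) ^ p).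

Local Notation cancellation l m := (gp (e l)^-1 (e m)).

Lemma same_gen (l m : L) : l.1 = m.1 -> m != letter_inv l -> m = l.
Proof.
by case: l m => [i s] [j t] /= ->; rewrite /letter_inv xpair_eqE /= eqxx; case: s t => [] [].
Qed.

(** For equal letters this is [gpV_lt]; otherwise, minimality with [p = 1] says that [e l * e m] is
    no shorter than [e l]. *)
Lemma reduced_cancel_pair l m : m != letter_inv l -> 2 * cancellation l m <= len (e m).
Proof.
move=> lm; have [/same_gen/(_ lm)->|ne] := eqVneq l.1 m.1.
  by rewrite gpC ltnW ?gpV_lt.
have := @e_min (letter_inv m) (letter_inv l) 1; rewrite eq_sym => /(_ ne).
rewrite !conjg1 (_ : e (letter_inv m) * _ = (e l * e m)^-1); last by rewrite invgM !eV.
rewrite !eV !lenV; have := len_mul (e l) (e m); lia.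
Qed.

(* If the middle factor of e b * e a * e b is entirely cancelled, then, p being
   the first half of e a, the pair (e a, e a * e b) conjugated by p is shorter. *)
Lemma reduced_cancel_bab a b : a.1 != b.1 ->
  cancellation b a + cancellation a b < len (e a).
Proof.
move=> ne; rewrite ltnNge; apply/negP => full.
have nba : a != letter_inv b by apply: contraNneq ne => ->.
have nab : b != letter_inv a by apply: contraNneq ne => ->.
have := reduced_cancel_pair nba; have := reduced_cancel_pair nab.
have := @e_min b a 1; rewrite eq_sym ne !conjg1 => /(_ isT).
have lab := len_mul (e a) (e b); have lba := len_mul (e b) (e a).
have a0 : 0 < len (e a) by rewrite lt0n len_eq0.
have := @e_min a b 1; rewrite ne !conjg1 => /(_ isT) m1 m2 c1 c2.
set u := e a in full lab lba a0 m1 m2 c1 c2 *; set v := e b in full lab lba m1 m2 c1 c2 *.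
set k := gp v^-1 u in full lba c1 c2 m1 m2.
(* Either side cancels at most half of [u], and together they cancel all of it, so each cancels
   exactly half. *)
have Eu : len u = (2 * k)%N by lia.
have kuv : gp u^-1 v = k by lia.
have [p lp pu] : exists2 p, len p = k & gp p u = k by apply: prefix_ex; lia.
have := len_divl p u; rewrite lp pu; set w : F := p^-1 * u => lw.
have lup : len (u ^ p) <= 2 * k.
  have -> : u ^ p = w * p by rewrite conjgE mulgA.
  by have := len_mul w p; lia.
have wu : k <= gp w^-1 u^-1.
  have := len_divl w^-1 u^-1; rewrite !lenV (_ : w^-1^-1 * u^-1 = p^-1) ?lenV; first lia.
  by rewrite invgK /w mulgK.
have wv : k <= gp w^-1 v by apply: (gp_ultra wu); rewrite kuv.
(* Here [v = w^-1 * t] without cancellation and [t] ends with [p^-1], so [(u * v) ^ p = t * p] has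
   length at most [len v - 2 * k]; as [len (u ^ p) <= 2 * k], this contradicts minimality. *)
have := len_mul w v; set t : F := w * v => lt.
have := gp_leql w^-1 v; rewrite lenV => le_wv.
have pv : k <= gp p v^-1 by apply: (@gp_ultra _ u); rewrite ?pu // gpC.
have tp : k <= gp p t^-1.
  apply: (gp_ultra pv).
  have := len_divl v^-1 t^-1; rewrite !lenV (_ : v^-1^-1 * t^-1 = w^-1) ?lenV; first lia.
  by rewrite invgK /t invgM mulVKg.
have := len_mul t p; rewrite gpC lp => ltp.
have := @e_min a b p ne; rewrite -/u -/v.
rewrite (_ : (u * v) ^ p = t * p); last by rewrite conjgE /t /w !mulgA.
lia.
Qed.

(** If two neighbours are equal, [gpV_lt] makes one bound strict. Otherwise [n] is [l], the previous
    lemma, or its inverse; in that case full cancellation would make [e m] and [(e m)^-1] agree on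
    half their length. *)
Lemma reduced_cancel_triple l m n : m != letter_inv l -> n != letter_inv m ->
  cancellation l m + cancellation m n < len (e m).
Proof.
move=> lm mn; have c1 := reduced_cancel_pair lm.
have c2 : 2 * cancellation m n <= len (e m).
  have := @reduced_cancel_pair (letter_inv n) (letter_inv m).
  by rewrite letter_invK eq_sym => /(_ mn); rewrite !eV invgK lenV gpC.
have [/same_gen/(_ lm) El|nlm] := eqVneq l.1 m.1.
  have := gpV_lt (e_neq1 l); rewrite gpC; subst m; lia.
have [/same_gen/(_ mn) En|nmn] := eqVneq m.1 n.1.
  have := gpV_lt (e_neq1 m); rewrite gpC; subst n; lia.
have Eln : l.1 = n.1 := two_gens nlm nmn.
have [En|/(same_gen Eln) ->] := eqVneq n (letter_inv l); last first.
  by apply: reduced_cancel_bab; rewrite eq_sym.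
rewrite En eV in c2 *; rewrite ltnNge; apply/negP => full.
have := gpV_lt (e_neq1 m); rewrite ltnNge => /negP; apply.
have h1 : cancellation l m <= gp (e m) (e l)^-1 by rewrite gpC.
have h2 : cancellation l m <= gp (e l)^-1 (e m)^-1 by rewrite [X in _ <= X]gpC; lia.
have := gp_ultra h1 h2; lia.
Qed.

Lemma reduced_len_eval_word w : reduced w -> size w <= len (eval_word e w).
Proof.
apply: len_eval_word => //; first exact: reduced_cancel_pair.
exact: reduced_cancel_triple.
Qed.

End NielsenReduced.

(** * Special automorphisms of the free group of rank two *)

Section FreeAut.
Variable X : choiceType.
Local Notation F := (free_group X).

Lemma free_hom_eq (G : groupType) (h k : {multiplicative F -> G}) :
  (forall x, h (gen x) = k (gen x)) -> h =1 k.
Proof.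
move=> hk u; rewrite (free_lift_unique (f := fun x => k (gen x)) hk).
by rewrite -(free_lift_unique (h := k)).
Qed.

Lemma lift_is_aut (f g : X -> F) :
  (forall x, free_lift f (g x) = gen x) -> (forall x, free_lift g (f x) = gen x) ->
  is_aut (free_lift f).
Proof.
move=> fg gf; split; first exact: free_lift_is_multiplicative.
exists (free_lift g) => u.
  apply: (@free_hom_eq _ (free_lift g \o free_lift f) idfun) => x /=.
  by rewrite free_lift_gen gf.
apply: (@free_hom_eq _ (free_lift f \o free_lift g) idfun) => x /=.
by rewrite free_lift_gen fg.
Qed.

Lemma conj_is_aut (G : groupType) (g : G) : is_aut (fun x => g * x * g^-1).
Proof.
split; first by move=> x y; rewrite !mulgA mulgVK.
by exists (fun x => g^-1 * x * g) => x; rewrite !mulgA ?mulVg ?mulgV mul1g ?mulgVK ?mulgK.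
Qed.

Definition inn (G : groupType) (g : G) : Aut G := MkAut (asboolT (conj_is_aut g)).

Lemma innM (G : groupType) (g h : G) : inn (g * h) = inn g * inn h.
Proof. by apply: aut_eq => x; rewrite aut_mulE /= invgM !mulgA. Qed.

Lemma innV (G : groupType) (g : G) : inn g^-1 = (inn g)^-1.
Proof.
apply: (mulgI (inn g)); rewrite mulgV -innM mulgV.
by apply: aut_eq => x; rewrite /= invg1 mulg1 mul1g.
Qed.

Lemma inn_aut (G : groupType) (f : Aut G) (g : G) : inn (f g) = f * inn g * f^-1.
Proof.
apply: (mulIg f); rewrite mulgVK; apply: aut_eq => x.
by rewrite !aut_mulE /= !autM autV.
Qed.

End FreeAut.

Section RankTwo.

Definition gx : F2 := gen ord0.
Definition gy : F2 := gen ord_max.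

Definition on_gens (u v : F2) (i : 'I_2) : F2 := if i == ord0 then u else v.

Lemma aut2_eq (f g : Aut F2) : f gx = g gx -> f gy = g gy -> f = g.
Proof.
move=> fgx fgy; apply: aut_eq; apply: free_hom_eq => -[[|[|//]] i2].
  by rewrite (_ : Ordinal i2 = ord0) //; apply: val_inj.
by rewrite (_ : Ordinal i2 = ord_max) //; apply: val_inj.
Qed.

Lemma lift2_is_aut (u v u' v' : F2) :
  free_lift (on_gens u v) u' = gx -> free_lift (on_gens u v) v' = gy ->
  free_lift (on_gens u' v') u = gx -> free_lift (on_gens u' v') v = gy ->
  `[< is_aut (free_lift (on_gens u v)) >].
Proof.
move=> h1 h2 h3 h4; apply/asboolP; apply: (@lift_is_aut _ _ (on_gens u' v')) => -[[|[|//]] i2].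
- by rewrite (_ : Ordinal i2 = ord0) //; apply: val_inj.
- by rewrite (_ : Ordinal i2 = ord_max) //; apply: val_inj.
- by rewrite (_ : Ordinal i2 = ord0) //; apply: val_inj.
- by rewrite (_ : Ordinal i2 = ord_max) //; apply: val_inj.
Qed.

(** The witnesses are the images of the generators under the inverse automorphism; identities
    between explicit elements of [F2] are checked by computing reduced words. *)
Fact sigma1_subproof : `[< is_aut (free_lift (on_gens (gx * gy) gy)) >].
Proof. by apply: (@lift2_is_aut _ _ (gx * gy^-1) gy); apply: val_inj. Qed.
Fact sigma2_subproof : `[< is_aut (free_lift (on_gens gx (gy * gx^-1))) >].
Proof. by apply: (@lift2_is_aut _ _ gx (gy * gx)); apply: val_inj. Qed.
Fact sigma3_subproof : `[< is_aut (free_lift (on_gens (gy * gx) gy)) >].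
Proof. by apply: (@lift2_is_aut _ _ (gy^-1 * gx) gy); apply: val_inj. Qed.

Definition sigma1 : Aut F2 := MkAut sigma1_subproof.
Definition sigma2 : Aut F2 := MkAut sigma2_subproof.
Definition sigma3 : Aut F2 := MkAut sigma3_subproof.

Lemma sigma12 : sigma1 * sigma2 * sigma1 = sigma2 * sigma1 * sigma2.
Proof. by apply: aut2_eq; apply: val_inj. Qed.
Lemma sigma23 : sigma2 * sigma3 * sigma2 = sigma3 * sigma2 * sigma3.
Proof. by apply: aut2_eq; apply: val_inj. Qed.
Lemma sigma13 : sigma1 * sigma3 = sigma3 * sigma1.
Proof. by apply: aut2_eq; apply: val_inj. Qed.

Lemma det_mx22 (R : comNzRingType) (A : 'M[R]_2) :
  (\det A = A ord0 ord0 * A ord_max ord_max - A ord0 ord_max * A ord_max ord0)%R.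
Proof.
rewrite (expand_det_row _ ord0) !big_ord_recl big_ord0 /cofactor !det_mx11 !mxE /=.
have l0 : lift ord0 0%R = ord_max :> 'I_2 by apply: val_inj.
have l1 : lift ord_max 0%R = ord0 :> 'I_2 by apply: val_inj.
by rewrite !l0 l1 expr0 expr1 mul1r mulN1r mulrN addr0.
Qed.

Lemma specialE f : special f =
  (expsum ord0 (f gx) * expsum ord_max (f gy) -
   expsum ord0 (f gy) * expsum ord_max (f gx) == 1)%R.
Proof. by rewrite /special det_mx22 !mxE. Qed.

Lemma sigma1_gens : (sigma1 gx = gx * gy) * (sigma1 gy = gy).
Proof. by split; apply: val_inj. Qed.
Lemma sigma2_gens : (sigma2 gx = gx) * (sigma2 gy = gy * gx^-1).
Proof. by split; apply: val_inj. Qed.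
Lemma sigma3_gens : (sigma3 gx = gy * gx) * (sigma3 gy = gy).
Proof. by split; apply: val_inj. Qed.

Lemma special_sigma1 : special sigma1.
Proof. by rewrite specialE !sigma1_gens !expsumM !expsum_gen. Qed.
Lemma special_sigma2 : special sigma2.
Proof. by rewrite specialE !sigma2_gens !expsumM !expsumV !expsum_gen. Qed.
Lemma special_sigma3 : special sigma3.
Proof. by rewrite specialE !sigma3_gens !expsumM !expsum_gen. Qed.

End RankTwo.

(** * Nielsen generation of SAut(F_2) *)

Section Generation.

Definition lett (l : letter 'I_2) : F2 := @FreeGroup _ [:: l] isT.

Lemma lettV l : lett (letter_inv l) = (lett l)^-1.
Proof. exact: val_inj. Qed.

Lemma lettE (l : letter 'I_2) : lett l = if l.2 then (gen l.1)^-1 else gen l.1.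
Proof. by case: l => i []; apply: val_inj. Qed.

Lemma aut_eval_word (f : Aut F2) w (rw : reduced w) :
  f (FreeGroup rw) = eval_word (fun l => f (lett l)) w.
Proof.
elim: w rw => [|l w IH] rw.
  by rewrite (_ : FreeGroup rw = 1) ?aut1 //; apply: val_inj.
have rw' : reduced w := path_sorted rw.
rewrite /= -(IH rw') -autM; congr (f _); apply: val_inj => /=.
by case: w rw {IH rw'} => //= m w /andP[/negPf ->].
Qed.

Lemma ord2P (i : 'I_2) : i = ord0 \/ i = ord_max.
Proof. by case: i => [[|[|//]] i2]; [left | right]; apply: val_inj. Qed.

(** [P] stands for a subgroup containing the three braid generators. *)
Variable P : Aut F2 -> Prop.
Hypotheses (P1 : P 1) (PM : forall f g, P f -> P g -> P (f * g)).
Hypothesis PV : forall f, P f -> P f^-1.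
Hypotheses (Ps1 : P sigma1) (Ps2 : P sigma2) (Ps3 : P sigma3).

Lemma gen_inn_gy : P (inn gy).
Proof.
suff -> : inn gy = sigma3 * sigma1^-1 by apply/PM/PV.
apply: (mulIg sigma1); rewrite mulgVK.
by apply: aut2_eq; apply: val_inj.
Qed.

Lemma gen_inn_gx : P (inn gx).
Proof.
rewrite -[inn gx]invgK -innV; apply: PV.
have -> : gx^-1 = (sigma1 * sigma2 * sigma1) gy by apply: val_inj.
by rewrite inn_aut; apply/PM/PV; [apply/PM/gen_inn_gy|]; do 2 ?apply: PM.
Qed.

(** The descent conjugates by arbitrary elements; [inn gy] is [sigma3 * sigma1^-1], and a conjugate
    of it in [P] is [inn gx^-1]. *)
Lemma gen_inn u : P (inn u).
Proof.
have Pgen i : P (inn (gen i)).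
  by case: (ord2P i) => ->; [apply: gen_inn_gx | apply: gen_inn_gy].
elim/free_group_ind: u => [|i u IH|i u IH]; rewrite ?innM ?innV.
- by rewrite -(mulgV gx) innM innV; apply/PM/PV; apply: gen_inn_gx.
- exact: PM.
- by apply: PM => //; apply: PV.
Qed.

Lemma transvectionV a b :
  (exists f : Aut F2, [/\ P f, f (lett a) = lett a & f (lett b) = lett a * lett b]) ->
  exists f : Aut F2, [/\ P f, f (lett (letter_inv a)) = lett (letter_inv a) &
    f (lett b) = lett (letter_inv a) * lett b].
Proof.
case=> f [Pf fa fb]; exists f^-1; split; first exact: PV.
  by apply: (can_inj (aut_funK f)); rewrite aut_invK !lettV autV fa.
by apply: (can_inj (aut_funK f)); rewrite aut_invK !lettV autM autV fa fb mulKg.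
Qed.

(** Inverting [f] inverts [a], so four cases remain. Right multiplication of a generator is left
    multiplication of its inverse. *)
Lemma transvection (a b : letter 'I_2) : a.1 != b.1 ->
  exists f : Aut F2, [/\ P f, f (lett a) = lett a & f (lett b) = lett a * lett b].
Proof.
case: a b => [i s] [j t] /=; case: (ord2P i) (ord2P j) => -> [] -> // _.
- case: t.
    suff h : exists f : Aut F2, [/\ P f, f (lett (ord0, false)) = lett (ord0, false) &
        f (lett (ord_max, true)) = lett (ord0, false) * lett (ord_max, true)].
      by case: s; [apply: (transvectionV h) | apply: h].
    by exists sigma2; split=> //; apply: val_inj.
  suff h : exists f : Aut F2, [/\ P f, f (lett (ord0, true)) = lett (ord0, true) &
      f (lett (ord_max, false)) = lett (ord0, true) * lett (ord_max, false)].
    by case: s; [apply: h | apply: (transvectionV h)].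
  (* [sigma2] multiplies y by x^-1 on the right; the conjugation moves this factor to the left. *)
  exists (sigma2 * inn gx^-1); split; [|exact: val_inj..].
  by apply: PM => //; apply: gen_inn.
- case: t.
    suff h : exists f : Aut F2, [/\ P f, f (lett (ord_max, true)) = lett (ord_max, true) &
        f (lett (ord0, true)) = lett (ord_max, true) * lett (ord0, true)].
      by case: s; [apply: h | apply: (transvectionV h)].
    by exists sigma1; split=> //; apply: val_inj.
  suff h : exists f : Aut F2, [/\ P f, f (lett (ord_max, false)) = lett (ord_max, false) &
      f (lett (ord0, false)) = lett (ord_max, false) * lett (ord0, false)].
    by case: s; [apply: (transvectionV h) | apply: h].
  by exists sigma3; split=> //; apply: val_inj.
Qed.

Hypothesis P_special : forall f, P f -> special f.

Definition rot : Aut F2 := inn gy^-1 * (sigma3 * sigma2 * sigma3).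

Lemma rot_gens : (rot gx = gy) * (rot gy = gx^-1).
Proof. by split; apply: val_inj. Qed.

(** Of the signed permutations of the generators, those of determinant 1 are the four powers of
    [rot]. *)
Lemma gen_letter_perm (f : Aut F2) : special f ->
  (exists a, f gx = lett a) -> (exists b, f gy = lett b) -> P f.
Proof.
have Prot : P rot by apply: PM; [apply: gen_inn | do 2 ?apply: PM].
move=> sf [[i s] fx] [[j t] fy].
move: sf; rewrite specialE fx fy !lettE /=.
case: (ord2P i) (ord2P j) => Ei [] Ej; subst i j; case: s t fx fy => [] [] fx fy;
  rewrite ?expsumV !expsum_gen // => _.
- suff -> : f = rot * rot by apply: PM.
  by apply: aut2_eq; rewrite ?fx ?fy aut_mulE; apply: val_inj.
- suff -> : f = 1 by [].
  by apply: aut2_eq; [exact: fx | exact: fy].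
- suff -> : f = rot * rot * rot by apply: PM => //; apply: PM.
  by apply: aut2_eq; rewrite ?fx ?fy !aut_mulE; apply: val_inj.
- suff -> : f = rot by [].
  by apply: aut2_eq; rewrite ?fx ?fy !rot_gens; apply: val_inj.
Qed.

Lemma specialM (f g : Aut F2) : special f -> special g -> special (f * g).
Proof. by rewrite /special ab_mxM det_mulmx => /eqP -> /eqP ->; rewrite mulr1. Qed.

Lemma specialV (f : Aut F2) : special f -> special f^-1.
Proof.
move=> sf; have := ab_mx1; rewrite -(mulVg f) ab_mxM => /(congr1 determinant).
by rewrite det_mulmx (eqP sf) det1 mulr1 => /eqP.
Qed.

Lemma sum_len_letters (f : Aut F2) (a b : letter 'I_2) : a.1 != b.1 ->
  len (f (lett a)) + len (f (lett b)) = len (f gx) + len (f gy).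
Proof.
have lenE l : len (f (lett l)) = len (f (gen l.1)).
  by rewrite lettE; case: l.2; rewrite ?autV ?lenV.
rewrite (lenE a) (lenE b); case: (ord2P a.1) (ord2P b.1) => -> [] -> // _.
by rewrite addnC.
Qed.

(* Nielsen's theorem in rank two: descent on the total length of the images of the
   generators, where conjugations are used along with transvections. *)
Theorem special_generated (f : Aut F2) : special f -> P f.
Proof.
have [n] := ubnP (len (f gx) + len (f gy)); elim: n f => // n IH f; rewrite ltnS => le_n sf.
have [|min_f] := pselect (exists a b p, a.1 != b.1 /\
    len (f (lett a) ^ p) + len ((f (lett a) * f (lett b)) ^ p) <
    len (f (lett a)) + len (f (lett b))).
  case=> a [b [p [ne lt_ab]]]; have [m [Pm ma mb]] := transvection ne.
  have innE u : inn p^-1 u = u ^ p by rewrite /= invgK conjgE mulgA.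
  have Pi := gen_inn p^-1.
  suff Pg : P (inn p^-1 * f * m).
    rewrite (_ : f = (inn p^-1)^-1 * (inn p^-1 * f * m) * m^-1); last first.
      by rewrite -!mulgA mulKg mulgV mulg1.
    by apply/PM/PV => //; apply/PM => //; apply: PV.
  apply: IH; last by do ![apply: specialM => //]; apply: P_special.
  rewrite -(sum_len_letters _ ne) !aut_mulE ma mb autM !innE; apply: leq_trans lt_ab _.
  by rewrite (sum_len_letters _ ne).
(* At a minimum the images of the letters are Nielsen reduced, so a word whose image has length 1
   has at most one letter. *)
have letter_preim i : exists a, f^-1 (gen i) = lett a.
  case Ew : (f^-1 (gen i)) => [w rw].
  have Ei : f (FreeGroup rw) = gen i by rewrite -Ew; apply: aut_invK.
  have : size w <= 1.
    suff : size w <= len (gen i) by [].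
    rewrite -Ei aut_eval_word; apply: reduced_len_eval_word => //.
    - by move=> x y z; case: (ord2P x) (ord2P y) (ord2P z) => -> [] -> [] ->.
    - by move=> l; rewrite lettV autV.
    - move=> l; rewrite -(aut1 f) (inj_eq (can_inj (aut_funK f))).
      by rewrite -len_eq0.
    - move=> a b p ne; rewrite leqNgt; apply/negP => lt_ab; apply: min_f.
      by exists a, b, p.
  case: w rw Ew Ei => [|a [|//]] rw Ew Ei _; last by exists a; apply: val_inj.
  have : gen i = 1 by rewrite -Ei -(aut1 f); congr (f _); apply: val_inj.
  by move/(congr1 (@word _)).
rewrite -[f]invgK; apply/PV/gen_letter_perm; first exact: specialV.
  exact: letter_preim.
exact: letter_preim.
Qed.

End Generation.

(** * Small quotients of the braid relations *)

Lemma hom1 (G H : groupType) (f : {multiplicative G -> H}) : f 1 = 1.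
Proof. by apply: (mulgI (f 1)); rewrite -gmulfM !mulg1. Qed.

Lemma homV (G H : groupType) (f : {multiplicative G -> H}) x : f x^-1 = (f x)^-1.
Proof. by apply: (mulgI (f x)); rewrite -gmulfM !mulgV hom1. Qed.

Section BraidQuotient.
Variable H : groupType.

(** Stated with duplicate-free lists, so that it makes sense before [T] is known to be finite. *)
Definition at_most_six (T : choiceType) := forall s : seq T, uniq s -> size s <= 6.

(** The elements of the symmetric group on three letters as reduced words in two adjacent
    transpositions. *)
Definition braid_elements (a b : H) : seq H := [:: 1; a; b; a * b; b * a; a * b * a].

(** After cancellation, any coincidence makes [a] and [b] commute. *)
Lemma braid_elements_uniq (a b : H) : a * b * a = b * a * b -> a * b <> b * a ->
  uniq (braid_elements a b).
Proof.
move=> braid nab; have a1 : a <> 1 by move=> e; apply: nab; rewrite e mulg1 mul1g.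
have b1 : b <> 1 by move=> e; apply: nab; rewrite e mulg1 mul1g.
have ab : a <> b by move=> e; apply: nab; rewrite e.
have abV : a * b <> 1 by move=> e; apply: nab; rewrite -(mulg1_eq e) mulgV mulVg.
have baV : b * a <> 1 by move=> e; apply: nab; rewrite -(mulg1_eq e) mulgV mulVg.
rewrite /= !inE !negb_or !andbT; do ![apply/andP; split]; apply/eqP => e.
- exact/a1/esym.
- exact/b1/esym.
- exact/abV/esym.
- exact/baV/esym.
- have h : b * (a * b * a) = a by rewrite !mulgA -braid -e mul1g.
  by apply: ab; rewrite -e mulg1 in h.
- exact: ab.
- by apply: b1; apply: (mulgI a); rewrite mulg1.
- by apply: b1; apply: (mulIg a); rewrite mul1g.
- by apply: abV; apply: (mulIg a); rewrite mul1g.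
- by apply: a1; apply: (mulIg b); rewrite mul1g.
- by apply: a1; apply: (mulgI b); rewrite mulg1.
- by apply: baV; apply: (mulIg b); rewrite mul1g -braid.
- exact: nab.
- by apply: a1; apply: (mulgI (a * b)); rewrite mulg1.
- by apply: a1; apply: (mulIg (b * a)); rewrite mul1g mulgA.
Qed.

Section Small.
Hypothesis small : at_most_six H.

Lemma mem_braid_elements (a b : H) : a * b * a = b * a * b -> a * b <> b * a ->
  forall h, h \in braid_elements a b.
Proof.
move=> braid nab h; apply/negPn/negP => nh.
have := small (s := h :: braid_elements a b).
by rewrite cons_uniq nh braid_elements_uniq // => /(_ isT).
Qed.

(** [a * a] is one of the six elements, and each choice other than 1 makes [a] and [b] commute. *)
Lemma braid_sqr (a b : H) : a * b * a = b * a * b -> a * b <> b * a -> a * a = 1.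
Proof.
move=> braid nab; have := mem_braid_elements braid nab (a * a).
rewrite !inE => /or4P[/eqP //|/eqP e|/eqP e|/or3P[] /eqP e]; case: nab.
- have -> : a = 1 by apply: (mulgI a); rewrite mulg1.
  by rewrite mulg1 mul1g.
- by rewrite -e mulgA.
- by rewrite (mulgI a _ _ e).
- by rewrite (mulIg a _ _ e).
- have -> : b = 1 by apply: (mulIg a); apply: (mulgI a); rewrite mul1g mulgA.
  by rewrite mulg1 mul1g.
Qed.

(** Among the six candidates, [c = 1] forces [b = 1] by the braid relation, and for the others
    except [a], commuting with [a] gives [a * b = b * a]. *)
Lemma braid_third (a b c : H) : a * b * a = b * a * b -> a * b <> b * a ->
  b * c * b = c * b * c -> a * c = c * a -> c = a.
Proof.
move=> braid nab braid' ac; have := mem_braid_elements braid nab c.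
rewrite !inE => /or4P[/eqP e|/eqP //|/eqP e|/or3P[] /eqP e]; case: nab; subst c.
- have -> : b = 1 by apply: (mulgI b); move: braid'; rewrite !mulg1 mul1g.
  by rewrite mulg1 mul1g.
- by [].
- by apply: (mulgI a); rewrite ac mulgA.
- by apply: (mulIg a); rewrite -ac mulgA.
- by apply: (mulgI a); apply: (mulIg a); rewrite !mulgA in ac *.
Qed.
End Small.

Definition spell (a b : H) (w : seq bool) : H := foldr (fun x h => (if x then a else b) * h) 1 w.

Lemma spell_cat a b v w : spell a b (v ++ w) = spell a b v * spell a b w.
Proof. by elim: v => [|x v IH] /=; rewrite ?mul1g // IH mulgA. Qed.

Lemma spell_rev a b w : a * a = 1 -> b * b = 1 -> spell a b (rev w) = (spell a b w)^-1.
Proof.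
move=> /mulg1_eq aV /mulg1_eq bV; elim: w => [|x w IH]; first by rewrite invg1.
rewrite rev_cons -cats1 spell_cat IH /= mulg1 invgM; congr (_ * _).
by case: x; rewrite ?aV ?bV.
Qed.

Definition normal_words : seq (seq bool) :=
  [:: [::]; [:: true]; [:: false]; [:: true; false]; [:: false; true]; [:: true; false; true]].

(** On normal words, each step is left multiplication by a generator in the symmetric group on three
    letters. *)
Fixpoint normalize (w : seq bool) : seq bool :=
  if w is x :: w' then
    match x, normalize w' with
    | true, true :: v => v
    | true, v => true :: v
    | false, false :: v => v
    | false, [:: true; false] => [:: true; false; true]
    | false, [:: true; false; true] => [:: true; false]
    | false, v => false :: v
    end
  else [::].

Lemma normalize_normal w : normalize w \in normal_words.
Proof.
elim: w => [|x w] //=; rewrite !inE.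
by case/or4P => [/eqP ->|/eqP ->|/eqP ->|/or3P[] /eqP ->]; case: x.
Qed.

Lemma spell_normalize a b w : a * a = 1 -> b * b = 1 -> a * b * a = b * a * b ->
  spell a b (normalize w) = spell a b w.
Proof.
move=> aa bb braid; elim: w => [|x w IH] //=; rewrite -IH.
have := normalize_normal w; rewrite !inE.
case/or4P => [/eqP ->|/eqP ->|/eqP ->|/or3P[] /eqP ->]; case: x => //=;
  rewrite ?mulg1 ?mulgA ?aa ?bb ?mul1g //.
by rewrite -braid -!mulgA aa mulg1.
Qed.

Lemma spell_normal_words a b :
  map (spell a b) normal_words = braid_elements a b.
Proof. by rewrite /= !mulg1 !mulgA. Qed.

Lemma spell_normal_inj a b : a * b * a = b * a * b -> a * b <> b * a ->
  {in normal_words &, injective (spell a b)}.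
Proof.
move=> braid nab v w vN wN e.
have uw : uniq (map (spell a b) normal_words).
  by rewrite spell_normal_words braid_elements_uniq.
rewrite -(nth_index [::] vN) -(nth_index [::] wN); congr (nth _ _ _).
apply/eqP; rewrite -(nth_uniq 1 _ _ uw) ?size_map ?index_mem //.
by rewrite !(nth_map [::]) ?index_mem // !nth_index // e.
Qed.

End BraidQuotient.

(** * Comparison of two small non-commuting quotients *)

Section TwoQuotients.
Variables (G : groupType) (s1 s2 s3 : G).
Hypothesis gen_ind : forall Q : G -> Prop, Q 1 ->
  (forall g h, Q g -> Q h -> Q (g * h)) -> (forall g, Q g -> Q g^-1) ->
  Q s1 -> Q s2 -> Q s3 -> forall g, Q g.
Hypotheses (braid12 : s1 * s2 * s1 = s2 * s1 * s2).
Hypotheses (braid23 : s2 * s3 * s2 = s3 * s2 * s3) (comm13 : s1 * s3 = s3 * s1).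

(** Commuting elements satisfying the braid relation are equal; this identifies [q s1] with [q s2],
    then with [q s3]. *)
Lemma cyclic_of_commuting (H : groupType) (q : {multiplicative G -> H}) :
  surjective q -> q s1 * q s2 = q s2 * q s1 -> cyclic_group H.
Proof.
move=> q_surj comm.
have q12 : q s1 = q s2.
  apply: (mulgI (q s2)); apply: (mulIg (q s1)).
  by rewrite -[in LHS]comm -!gmulfM braid12 !gmulfM -[LHS]mulgA comm mulgA.
have q13 : q s3 = q s1.
  have := congr1 q braid23; have := congr1 q comm13; rewrite !gmulfM -q12 => c13.
  by rewrite -[LHS]mulgA -c13 -[RHS]mulgA => /mulgI/mulIg.
exists (q s1) => y; have [g <-] := q_surj y.
(* Exponents being natural numbers, an integer power is carried as a quotient of two powers. *)
have [m [n ->]] : exists m n, q g = q s1 ^+ m / q s1 ^+ n.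
  have cX k l : commute (q s1 ^+ k) (q s1 ^+ l) by apply/commuteX2/commute_refl.
  elim/gen_ind: g => [|g h [m [n qg]] [m' [n' qh]]|g [m [n qg]]|||].
  - by exists 0%N, 0%N; rewrite hom1 mulgV.
  - exists (m + m'), (n' + n); rewrite gmulfM qg qh !expgnDr invgM !mulgA.
    by congr (_ * _); rewrite -!mulgA; congr (_ * _); apply/esym/commuteV.
  - by exists n, m; rewrite homV qg invgF.
  - by exists 1%N, 0%N; rewrite divg1.
  - by exists 1%N, 0%N; rewrite divg1 q12.
  - by exists 1%N, 0%N; rewrite divg1 q13.
have [le_nm|/ltnW le_mn] := leqP n m.
  by exists (m - n); left; rewrite expgnFr.
by exists (n - m); right; rewrite expgnFr // invgF.
Qed.

(** Both images satisfy the same relations, so a word found from [g] is valid in both, and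
    [normalize] does not look at the group. *)
Lemma spell_quotients (H H' : groupType) (q : {multiplicative G -> H})
    (p : {multiplicative G -> H'}) :
  at_most_six H -> at_most_six H' ->
  q s1 * q s2 <> q s2 * q s1 -> p s1 * p s2 <> p s2 * p s1 ->
  forall g, exists2 w, w \in normal_words &
    q g = spell (q s1) (q s2) w /\ p g = spell (p s1) (p s2) w.
Proof.
move=> small_q small_p nq np g.
have relations (K : groupType) (r : {multiplicative G -> K}) : at_most_six K ->
    r s1 * r s2 <> r s2 * r s1 ->
    [/\ r s1 * r s1 = 1, r s2 * r s2 = 1, r s3 = r s1 &
        r s1 * r s2 * r s1 = r s2 * r s1 * r s2].
  move=> small nr; have br := congr1 r braid12; have br' := congr1 r braid23.
  have cr := congr1 r comm13; rewrite !gmulfM in br br' cr.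
  have nr' : r s2 * r s1 <> r s1 * r s2 by move=> /esym.
  split=> //; first exact: braid_sqr br nr; first exact: braid_sqr (esym br) nr'.
  exact: braid_third br nr br' cr.
have [qaa qbb qc qbr] := relations _ _ small_q nq.
have [paa pbb pc pbr] := relations _ _ small_p np.
suff [w [qw pw]] : exists w, q g = spell (q s1) (q s2) w /\ p g = spell (p s1) (p s2) w.
  by exists (normalize w); rewrite ?normalize_normal ?spell_normalize.
elim/gen_ind: g => [|g h [v [qv pv]] [w [qw pw]]|g [w [qw pw]]|||].
- by exists [::]; rewrite !hom1.
- by exists (v ++ w); rewrite !gmulfM !spell_cat qv qw pv pw.
- by exists (rev w); rewrite !homV !spell_rev // qw pw.
- by exists [:: true]; rewrite /= !mulg1.
- by exists [:: false]; rewrite /= !mulg1.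
- by exists [:: true]; rewrite /= !mulg1 qc pc.
Qed.

Lemma small_quotient_iso (H H' : groupType) (q : {multiplicative G -> H})
    (p : {multiplicative G -> H'}) :
  at_most_six H -> at_most_six H' -> surjective q ->
  q s1 * q s2 <> q s2 * q s1 -> p s1 * p s2 <> p s2 * p s1 ->
  exists2 f : {multiplicative H' -> H}, bijective f & forall g, q g = f (p g).
Proof.
move=> small_q small_p q_surj nq np.
have spellP := spell_quotients small_q small_p nq np.
have brq : q s1 * q s2 * q s1 = q s2 * q s1 * q s2 by rewrite -!gmulfM braid12.
have brp : p s1 * p s2 * p s1 = p s2 * p s1 * p s2 by rewrite -!gmulfM braid12.
(* The six braid elements exhaust [H'], and each is visibly an image. *)
have p_surj h : exists g, p g = h.
  have : h \in braid_elements (p s1) (p s2) by apply: mem_braid_elements.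
  rewrite !inE => /or4P[/eqP ->|/eqP ->|/eqP ->|/or3P[] /eqP ->].
  - by exists 1; rewrite hom1.
  - by exists s1.
  - by exists s2.
  - by exists (s1 * s2); rewrite gmulfM.
  - by exists (s2 * s1); rewrite gmulfM.
  - by exists (s1 * s2 * s1); rewrite !gmulfM.
have eq_qp g h : q g = q h <-> p g = p h.
  have [v vN [-> ->]] := spellP g; have [w wN [-> ->]] := spellP h.
  by split=> /spell_normal_inj -> //.
(* By [eq_qp], the value does not depend on the chosen preimage. *)
pose f h := q (projT1 (cid (p_surj h))).
have fp g : f (p g) = q g by rewrite /f; case: cid => h /= /eq_qp.
have fM : {morph f : x y / x * y}.
  move=> x y; have [g <-] := p_surj x; have [h <-] := p_surj y.
  by rewrite -gmulfM !fp gmulfM.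
pose F : {multiplicative H' -> H} := HB.pack f (isMultiplicative.Build _ _ f fM).
exists F; last by move=> g; rewrite /= fp.
have [g gK] : exists g : H -> H', forall h, F (g h) = h.
  have F_surj h : exists x, F x = h.
    by have [g <-] := q_surj h; exists (p g); apply: fp.
  by exists (fun h => projT1 (cid (F_surj h))) => h; case: cid.
exists g => // x; have [u <-] := p_surj x; have [v ev] := p_surj (g (F (p u))).
rewrite -ev; apply/eq_qp; rewrite -!fp ev; exact: gK.
Qed.

End TwoQuotients.

(** * The three sources *)

Section Sources.

Definition realizes (f : Aut F2) (a b c d : int) : Prop :=
  [/\ expsum ord0 (f gx) = a, expsum ord0 (f gy) = b,
      expsum ord_max (f gx) = c & expsum ord_max (f gy) = d].

Definition realizable (a b c d : int) : Prop := exists f, realizes f a b c d.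

Local Open Scope ring_scope.

(** For the matrix with rows [a, b] and [c, d], composing with [sigma1] on the right adds the second
    column to the first. *)
Lemma realizable_col1 a b c d : realizable (a + b) b (c + d) d <-> realizable a b c d.
Proof.
split=> -[f [fa fb fc fd]].
  exists (f * sigma1^-1)%g.
  have s1 : (sigma1^-1)%g gx = (gx * gy^-1)%g.
    by apply: (can_inj (aut_funK sigma1)); rewrite aut_invK; apply: val_inj.
  have s2 : (sigma1^-1)%g gy = gy.
    by apply: (can_inj (aut_funK sigma1)); rewrite aut_invK; apply: val_inj.
  by split; rewrite aut_mulE ?s1 ?s2 ?autM ?autV ?expsumM ?expsumV ?fa ?fb ?fc ?fd ?addrK.
exists (f * sigma1)%g.
by split; rewrite aut_mulE ?sigma1_gens ?autM ?autV ?expsumM ?expsumV ?fa ?fb ?fc ?fd.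
Qed.

Lemma realizable_col2 a b c d : realizable a (b - a) c (d - c) <-> realizable a b c d.
Proof.
split=> -[f [fa fb fc fd]].
  exists (f * sigma2^-1)%g.
  have s1 : (sigma2^-1)%g gx = gx.
    by apply: (can_inj (aut_funK sigma2)); rewrite aut_invK; apply: val_inj.
  have s2 : (sigma2^-1)%g gy = (gy * gx)%g.
    by apply: (can_inj (aut_funK sigma2)); rewrite aut_invK; apply: val_inj.
  by split; rewrite aut_mulE ?s1 ?s2 ?autM ?autV ?expsumM ?expsumV ?fa ?fb ?fc ?fd ?subrK.
exists (f * sigma2)%g.
by split; rewrite aut_mulE ?sigma2_gens ?autM ?autV ?expsumM ?expsumV ?fa ?fb ?fc ?fd.
Qed.

Lemma realizable_rot a b c d : realizable a b c d -> realizable b (- a) d (- c).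
Proof.
move=> -[f [fa fb fc fd]]; exists (f * rot)%g.
by split; rewrite aut_mulE ?rot_gens ?autV ?expsumV ?fa ?fb ?fc ?fd.
Qed.

(* Euclid's algorithm on the first row of the matrix. *)
Lemma realizable_det1 (a b c d : int) : a * d - b * c = 1 -> realizable a b c d.
Proof.
have col1N (a' b' c' d' : int) : realizable (a' - b') b' (c' - d') d' -> realizable a' b' c' d'.
  by rewrite -realizable_col1 !subrK.
have col2N (a' b' c' d' : int) : realizable a' (b' + a') c' (d' + c') -> realizable a' b' c' d'.
  by rewrite -realizable_col2 !addrK.
(* The matrix of [rot] has order four, so three more turns undo one. *)
have rot3 (a' b' c' d' : int) : realizable b' (- a') d' (- c') -> realizable a' b' c' d'.
  by do 3 move/realizable_rot; rewrite !opprK.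
have unip e : realizable 1 0 e 1.
  elim/int_rect: e => [|n IH|n IH].
  - by exists 1%g; split; apply: expsum_gen.
  - by apply: col1N; rewrite subr0 (_ : _ - 1 = n%:Z) //; lia.
  - by apply/realizable_col1; rewrite addr0 (_ : _ + 1 = - n%:Z) //; lia.
have diag (a' c' d' : int) : a' * d' = 1 -> realizable a' 0 c' d'.
  move=> ad; have /eqP := congr1 absz ad; rewrite abszM muln_eq1 => /andP[/eqP na _].
  have [ea|ea] : a' = 1 \/ a' = -1 by lia.
    have ed : d' = 1 by lia.
    by rewrite ea ed; apply: unip.
  have ed : d' = -1 by lia.
  by rewrite ea ed; apply/rot3/rot3; rewrite !oppr0 opprK; apply: unip.
have [n] := ubnP (absz a + absz b)%N; elim: n a b c d => // n IH a b c d; rewrite ltnS => le_n det.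
have [b0|b0] := eqVneq b 0; first by subst b; apply: diag; lia.
have [a0|a0] := eqVneq a 0.
  by subst a; apply: rot3; rewrite oppr0; apply: diag; lia.
(* The nonzero entry of smaller or equal absolute value is added to or subtracted from the other,
   according to the signs. *)
have [[h|h]|[h|h]] : ((absz (a - b)%R < absz a)%N \/ (absz (a + b)%R < absz a)%N) \/
    ((absz (b - a)%R < absz b)%N \/ (absz (b + a)%R < absz b)%N) by lia.
- by apply: col1N; apply: IH; [lia | rewrite -det; ring].
- by apply/realizable_col1; apply: IH; [lia | rewrite -det; ring].
- by apply/realizable_col2; apply: IH; [lia | rewrite -det; ring].
- by apply: col2N; apply: IH; [lia | rewrite -det; ring].
Qed.

Lemma SAut_SL_surj : surjective SAut_SL.
Proof.
move=> M; have := SL_det M; rewrite det_mx22 => /realizable_det1[f [fa fb fc fd]].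
have sf : special f by rewrite specialE fa fb fc fd -det_mx22 SL_det.
exists (MkSAut sf); apply: val_inj; apply/matrixP => i j.
by rewrite /= !mxE; case: (ord2P i) (ord2P j) => -> [] ->.
Qed.

Local Open Scope group_scope.

Lemma to_SOut_subproof (f : SAutF2) : special_out (to_Out (SAut_val f)).
Proof. by apply/asboolP; exists (SAut_val f) => //; apply: (valP f). Qed.
Definition to_SOut (f : SAutF2) : SOutF2 := MkSOut (to_SOut_subproof f).

Lemma to_SOutM : {morph to_SOut : f g / f * g}.
Proof. by move=> f g; apply: val_inj; apply: to_OutM. Qed.
HB.instance Definition _ := isMultiplicative.Build _ _ to_SOut to_SOutM.

Lemma to_SOut_surj : surjective to_SOut.
Proof.
move=> x; have /asboolP[f sf fx] := valP x.
by exists (MkSAut sf); apply: val_inj.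
Qed.

Lemma SOut_SL_to_SOut f : SOut_SL (to_SOut f) = SAut_SL f.
Proof. by apply: val_inj; apply: ab_mx_out; apply: Out_reprK. Qed.

Definition from_SAut (s : source) : {multiplicative SAutF2 -> source_group s} :=
  match s with
  | fromSAut => idfun
  | fromSOut => to_SOut
  | fromSL => SAut_SL
  end.

Lemma from_SAut_surj s : surjective (from_SAut s).
Proof.
case: s; [by move=> x; exists x | exact: to_SOut_surj | exact: SAut_SL_surj].
Qed.

Lemma natural_map_from_SAut s g :
  natural_map s (from_SAut s g) = natural_map fromSAut g.
Proof. by case: s => //=; rewrite SOut_SL_to_SOut. Qed.

End Sources.

(** * Generators and braid relations in SAut(F_2) *)

Definition S1 : SAutF2 := MkSAut special_sigma1.
Definition S2 : SAutF2 := MkSAut special_sigma2.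
Definition S3 : SAutF2 := MkSAut special_sigma3.

(** Nielsen generation is applied in [Aut F2] to the property of lifting to an element of [SAutF2]
    that satisfies [Q]. *)
Lemma SAut_ind (Q : SAutF2 -> Prop) : Q 1 ->
  (forall g h, Q g -> Q h -> Q (g * h)) -> (forall g, Q g -> Q g^-1) ->
  Q S1 -> Q S2 -> Q S3 -> forall g, Q g.
Proof.
move=> Q1 QM QV QS1 QS2 QS3 g.
suff [h hg Qh] : exists2 h, SAut_val h = SAut_val g & Q h.
  by rewrite -(val_inj hg).
apply: (special_generated (P := fun f => exists2 h, SAut_val h = f & Q h)).
- by exists 1.
- by move=> _ _ [h <- Qh] [k <- Qk]; exists (h * k); [|apply: QM].
- by move=> _ [h <- Qh]; exists h^-1; [|apply: QV].
- by exists S1.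
- by exists S2.
- by exists S3.
- by move=> _ [h <- _]; apply: (valP h).
- exact: (valP g).
Qed.

Lemma S_braid12 : S1 * S2 * S1 = S2 * S1 * S2.
Proof. exact/val_inj/sigma12. Qed.
Lemma S_braid23 : S2 * S3 * S2 = S3 * S2 * S3.
Proof. exact/val_inj/sigma23. Qed.
Lemma S_comm13 : S1 * S3 = S3 * S1.
Proof. exact/val_inj/sigma13. Qed.

(** * Counting SL(2, Z/2) and comparing cardinalities *)

Lemma Z2P (x : 'Z_2) : x = 0%R \/ x = 1%R.
Proof. by case: x => [[|[|//]] i]; [left | right]; apply: val_inj. Qed.

(** Over two elements a matrix is determined by which entries vanish; these patterns can be
    enumerated by computation. *)
Definition SL2_key (A : SL 2 'Z_2) : bool * bool * bool * bool :=
  (A ord0 ord0 == 0, A ord0 ord_max == 0, A ord_max ord0 == 0, A ord_max ord_max == 0)%R.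

Lemma SL2_key_inj : injective SL2_key.
Proof.
have eq0_inj (x y : 'Z_2) : (x == 0%R) = (y == 0%R) -> x = y.
  by case: (Z2P x) (Z2P y) => -> [] ->.
move=> A B [/eq0_inj e00 /eq0_inj e01 /eq0_inj e10 /eq0_inj e11].
by apply: val_inj; apply/matrixP => i j; case: (ord2P i) (ord2P j) => -> [] ->.
Qed.

Definition SL2_keys : seq (bool * bool * bool * bool) :=
  [:: (false, true, true, false); (true, false, false, true); (false, false, true, false);
      (false, true, false, false); (false, false, false, true); (true, false, false, false)].

Lemma SL2_key_mem A : SL2_key A \in SL2_keys.
Proof.
have := SL_det A; rewrite det_mx22 /SL2_key.
case: (Z2P (A ord0 ord0)) (Z2P (A ord0 ord_max)) => -> [] ->;
by case: (Z2P (A ord_max ord0)) (Z2P (A ord_max ord_max)) => -> [] -> // /eqP.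
Qed.

Lemma SL2_at_most_six : at_most_six (SL 2 'Z_2).
Proof.
move=> s us; rewrite -(size_map SL2_key); apply: (uniq_leq_size (s2 := SL2_keys)).
  by rewrite map_inj_uniq //; apply: SL2_key_inj.
by move=> _ /mapP[A _ ->]; apply: SL2_key_mem.
Qed.

Lemma natural_map_S12 : natural_map fromSAut S1 * natural_map fromSAut S2 <>
  natural_map fromSAut S2 * natural_map fromSAut S1.
Proof.
(* The upper left entries of the two products are 1 and 0. *)
move=> /(congr1 (fun A : SL 2 'Z_2 => A ord0 ord0)).
rewrite /= !mxE !big_ord_recl !big_ord0 !mxE /=.
by rewrite !free_lift_gen /on_gens /= !expsumM !expsumV !expsum_gen => /eqP.
Qed.

Lemma card_le_setTP (A B : Type) :
  reflect (exists f : A -> B, injective f) (@setT A #<= @setT B)%card.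
Proof.
apply: (iffP card_leP) => [[f]|[f f_inj]]; last first.
  apply/card_leP; have /injfunPex[g] : exists2 f : A -> B,
      set_fun setT setT f & set_inj setT f by exists f => // x y _ _; apply: f_inj.
  exact: inj_card_le g.
exists (fun a => val (f (to_setT a))) => x y /val_inj.
by move/(inj (mem_setT _) (mem_setT _))/(congr1 val).
Qed.

Lemma card_lt_or_at_most_six (H : choiceType) :
  card_lt (SL 2 'Z_2) H \/ at_most_six H.
Proof.
have [|no7] := pselect (exists s : seq H, uniq s /\ 6 < size s); last first.
  by right=> s us; rewrite leqNgt; apply/negP => lt_s; apply: no7; exists s.
case=> s [us lt_s]; left; split.
  apply/card_le_setTP; case: s us lt_s => // x s us lt_s.
  (* The position of the key among six picks one of at least seven distinct elements, so the default
     [x] is never reached. *)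
  exists (fun A => nth x (x :: s) (index (SL2_key A) SL2_keys)) => A B /eqP.
  have lt_index C : index (SL2_key C) SL2_keys < size (x :: s).
    by apply: leq_trans lt_s; rewrite ltnS ltnW // -[6]/(size SL2_keys) index_mem SL2_key_mem.
  rewrite nth_uniq // => /eqP eAB; apply: SL2_key_inj.
  by rewrite -(nth_index (SL2_key A) (SL2_key_mem A)) eAB nth_index ?SL2_key_mem.
move=> /card_le_setTP[f f_inj]; have := SL2_at_most_six (s := map f s).
by rewrite map_inj_uniq // us size_map leqNgt lt_s => /(_ isT).
Qed.

Lemma small_quotient_SAut (H : groupType) (q : {multiplicative SAutF2 -> H}) :
  surjective q -> ~ cyclic_group H -> at_most_six H ->
  exists2 f : {multiplicative SL 2 'Z_2 -> H}, bijective f &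
    forall g, q g = f (natural_map fromSAut g).
Proof.
move=> q_surj ncyc small.
apply: (small_quotient_iso SAut_ind S_braid12 S_braid23 S_comm13) => //.
- exact: SL2_at_most_six.
- move=> comm; apply: ncyc.
  exact: (cyclic_of_commuting SAut_ind S_braid12 S_braid23 S_comm13 q_surj).
- exact: natural_map_S12.
Qed.

Theorem mainTheorem2 (s : source) (H : groupType)
    (q : {multiplicative source_group s -> H}) :
  surjective q ->
  ~ cyclic_group H ->
  (card_lt (SL 2 'Z_2) H \/ isomorphic H (SL 2 'Z_2)) /\
  (forall i : {multiplicative H -> SL 2 'Z_2}, bijective i ->
     exists a : Aut (SL 2 'Z_2),
       forall g : source_group s, i (q g) = a (natural_map s g)).
Proof.
move=> q_surj ncyc.
(* Precomposing with the surjection [from_SAut s] reduces to SAut(F_2); the factorization descends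
   because the natural maps are compatible. *)
have small_iso : at_most_six H -> exists2 f : {multiplicative SL 2 'Z_2 -> H},
    bijective f & forall g, q g = f (natural_map s g).
  move=> small; have [h|f f_bij fP] := small_quotient_SAut (q := q \o from_SAut s) _ ncyc small.
    by have [g <-] := q_surj h; have [k <-] := from_SAut_surj g; exists k.
  exists f => // g; have [k <-] := from_SAut_surj g.
  by rewrite natural_map_from_SAut -fP.
split.
  have [lt_H|/small_iso[f [f' fK f'K] _]] := card_lt_or_at_most_six H; first by left.
  right; have f'M : {morph f' : x y / x * y} := can2_gmulfM fK f'K.
  pose F : {multiplicative H -> SL 2 'Z_2} := HB.pack f' (isMultiplicative.Build _ _ f' f'M).
  by exists F, f.
(* The injection [i] bounds the size of [H]; the required automorphism is then [i \o f]. *)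
move=> i i_bij; have [|f f_bij fP] := small_iso.
  move=> t ut; rewrite -(size_map i); apply: SL2_at_most_six.
  by rewrite map_inj_uniq //; apply: bij_inj.
have aP : is_aut (i \o f) by split; [move=> x y; rewrite /= !gmulfM | apply: bij_comp].
by exists (MkAut (asboolT aP)) => g; rewrite fP.
Qed.
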